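(* There is an absolute constant $C>0$ such that the following holds. Let $m\ge 2$, let $A\in\mathbb{R}^{m\times n}$ have rank $m$, let $b\in\mathbb{R}^m$, and let $P=\{x\in\mathbb{R}^n : Ax=b,\ x\ge \mathbf{0}\}$. Then the monotone circuit diameter of $P$ is at most $C\,m^2\log m$.
   Context: For a vector $z\in\mathbb{R}^n$, $\operatorname{supp}(z)=\{i: z_i\ne 0\}$. An elementary vector of $A$ is a nonzero vector $g\in\ker(A)$ of inclusion-minimal support, i.e. there is no $h\in\ker(A)\setminus\{\mathbf 0\}$ with $\operatorname{supp}(h)\subsetneq\operatorname{supp}(g)$. A circuit walk in $P$ of length $k$ from $x$ to $y$ is a sequence $x=x^{(0)},x^{(1)},\ldots,x^{(k)}=y$ of points of $P$ such that for each $i\in\{0,\dots,k-1\}$ one has $x^{(i+1)}=x^{(i)}+\alpha^{(i)}g^{(i)}$ for some elementary vector $g^{(i)}$ of $A$ and some real $\alpha^{(i)}>0$ that is chosen maximally, i.e. $x^{(i)}+\alpha' g^{(i)}\notin P$ for every $\alpha'>\alpha^{(i)}$. A circuit walk $(x^{(0)},\ldots,x^{(k)})$ is monotone with respect to $c\in\mathbb{R}^n$ if $c^\top x^{(i+1)}\le c^\top x^{(i)}$ for all $i\in\{0,\ldots,k-1\}$. The monotone circuit diameter of $P$ is the maximum, over all vertices $u,v$ of $P$ and all objectives $c\in\mathbb{R}^n$ with $v\in\operatorname{arg\,min}_{x\in P}c^\top x$, of the length of a shortest circuit walk from $u$ to $v$ that is monotone with respect to $c$. *)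

(* Defs.v *)
From mathcomp Require Import all_boot all_order all_algebra.
From mathcomp Require Import all_classical all_reals all_analysis.

Set Implicit Arguments.
Unset Strict Implicit.
Unset Printing Implicit Defensive.

Import Order.TTheory GRing.Theory Num.Theory.
Local Open Scope classical_set_scope.
Local Open Scope ring_scope.

Definition polyhedron (R : realType) (m n : nat) (A : 'M[R]_(m, n))
    (b : 'cV[R]_m) : set 'cV[R]_n :=
  [set x | A *m x = b /\ forall i, 0 <= x i 0].

(* The vertices of a polyhedron are its extreme points. *)
Definition vertex (R : realType) (n : nat) (P : set 'cV[R]_n)
    (x : 'cV[R]_n) : Prop :=
  P x /\ forall (y z : 'cV[R]_n) (t : R), P y -> P z -> 0 < t < 1 ->
    x = t *: y + (1 - t) *: z -> y = x /\ z = x.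

Definition supp (R : realType) (n : nat) (z : 'cV[R]_n) : {set 'I_n} :=
  [set i | z i 0 != 0]%SET.

Definition elementary (R : realType) (m n : nat) (A : 'M[R]_(m, n))
    (g : 'cV[R]_n) : Prop :=
  [/\ g != 0, A *m g = 0 &
      ~ exists h : 'cV[R]_n, [/\ h != 0, A *m h = 0 & supp h \proper supp g]].

Definition circuit_step (R : realType) (m n : nat) (A : 'M[R]_(m, n))
    (b : 'cV[R]_m) (x y : 'cV[R]_n) : Prop :=
  exists (g : 'cV[R]_n) (alpha : R),
    [/\ elementary A g, 0 < alpha, y = x + alpha *: g &
        forall alpha' : R, alpha < alpha' ->
          ~ polyhedron A b (x + alpha' *: g)].

(* Only the values [w 0], ..., [w k] are meaningful. *)
Definition circuit_walk (R : realType) (m n : nat) (A : 'M[R]_(m, n))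
    (b : 'cV[R]_m) (k : nat) (w : nat -> 'cV[R]_n) (x y : 'cV[R]_n) : Prop :=
  [/\ w 0%N = x, w k = y,
      forall i : nat, (i <= k)%N -> polyhedron A b (w i) &
      forall i : nat, (i < k)%N -> circuit_step A b (w i) (w i.+1)].

Definition objective (R : realType) (n : nat) (c x : 'cV[R]_n) : R :=
  (c^T *m x) 0 0.

Definition monotone_walk (R : realType) (n : nat) (c : 'cV[R]_n) (k : nat)
    (w : nat -> 'cV[R]_n) : Prop :=
  forall i : nat, (i < k)%N -> objective c (w i.+1) <= objective c (w i).

Definition argmin (R : realType) (n : nat) (P : set 'cV[R]_n)
    (c : 'cV[R]_n) : set 'cV[R]_n :=
  [set v | P v /\ forall x, P x -> objective c v <= objective c x].

(* Length of a shortest walk; it is [+oo] when there is no walk. *)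
Definition monotone_circuit_dist (R : realType) (m n : nat)
    (A : 'M[R]_(m, n)) (b : 'cV[R]_m) (c u v : 'cV[R]_n) : \bar R :=
  ereal_inf [set (k%:R)%:E | k in [set k : nat |
    exists w : nat -> 'cV[R]_n,
      circuit_walk A b k w u v /\ monotone_walk c k w]].

(* The value is [-oo] when the polyhedron is empty; a nonempty polyhedron of
   this form has a vertex [u], and the triple [(u, u, 0)] is admissible, so the
   value is then nonnegative. *)
Definition monotone_circuit_diameter (R : realType) (m n : nat)
    (A : 'M[R]_(m, n)) (b : 'cV[R]_m) : \bar R :=
  ereal_sup [set d | exists u v c : 'cV[R]_n,
    [/\ vertex (polyhedron A b) u, vertex (polyhedron A b) v,
        argmin (polyhedron A b) c v & d = monotone_circuit_dist A b c u v]].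

(* Main.v *)
Require Import Defs.
From mathcomp Require Import all_boot all_order all_algebra.
From mathcomp Require Import all_classical all_reals all_analysis.
From mathcomp Require Import ring lra.

Set Implicit Arguments.
Unset Strict Implicit.
Unset Printing Implicit Defensive.

Import Order.TTheory GRing.Theory Num.Theory.
Local Open Scope ring_scope.

(* Put p = 2m, which bounds the size of supp u :|: supp v, and call the
   coordinate i of a point x large if x_i > p v_i. The set of large coordinates
   never grows and loses an element every O(p log p) steps, so that v is
   reached in O(m^2 log m) steps.
   Fix i0 with v_i0 = 0 < (x0)_i0. Stepping along the piece of a conformal
   decomposition of v - x with the largest i0-entry multiplies x_i0 by at most
   1 - 1/p; the largest i0-entry also bounds the step length by p, so no
   coordinate becomes large. After O(p log p) such steps we are at x1 with
   (x1)_i0 <= (x0)_i0 / 6p^3. If no coordinate has stopped being large, step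
   along a piece of -(2p (x1 - v) + (x0 - v)): it is so short, relative to
   (x1)_i0, that only a large coordinate can block it, and that one drops to 0.
   All directions are nonpositive where v vanishes, hence monotone for every
   objective minimized at v. *)

(** * Ratio test and conformal circuits *)

(** The step is the least ratio [x i / h i] over [h i > 0]; the minimizing index blocks [x - a h] by
    reaching 0. *)
Lemma maximal_step (R : realFieldType) (n : nat) (x h : 'I_n -> R) :
  (exists i, 0 < h i) -> (forall i, 0 < h i -> 0 < x i) ->
  (forall i, 0 <= x i) ->
  exists a i, [/\ 0 < a, 0 < h i, a * h i = x i & forall j, a * h j <= x j].
Proof.
move=> [i0 hi0] hx x0.
case: (@arg_minP _ R _ i0 (fun i => 0 < h i) (fun i => x i / h i) hi0) => i hi le_i.
exists (x i / h i), i; split => //.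
- by rewrite divr_gt0 ?hx.
- by rewrite divfK ?gt_eqF.
move=> j; have [hj|hj] := ltP 0 (h j).
  by rewrite -ler_pdivlMr ?le_i.
by apply: le_trans (x0 j); rewrite mulr_ge0_le0 // divr_ge0 ?x0 // ltW.
Qed.

Lemma in_supp (R : realType) (n : nat) (z : 'cV[R]_n) i :
  (i \in supp z) = (z i 0 != 0).
Proof. by rewrite inE. Qed.

Lemma cV_neq0 (R : realType) (n : nat) (z : 'cV[R]_n) :
  z != 0 -> exists i, z i 0 != 0.
Proof.
move=> z0; apply/existsP; apply: contraNT z0; rewrite negb_exists => /forallP z0.
by apply/eqP/colP => i; rewrite mxE; apply/eqP; have := z0 i; rewrite negbK.
Qed.

Lemma elementary_scale (R : realType) (m n : nat) (A : 'M[R]_(m, n))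
    (g : 'cV[R]_n) (a : R) :
  a != 0 -> elementary A g -> elementary A (a *: g).
Proof.
move=> a0 [g0 Ag ming]; split.
- by rewrite scaler_eq0 negb_or a0.
- by rewrite -scalemxAr Ag scaler0.
suff -> : supp (a *: g) = supp g by [].
by apply/setP => i; rewrite !in_supp mxE mulf_eq0 negb_or a0.
Qed.

(** Induction on the support: if [f] is not elementary, a kernel vector [h] of smaller support is
    subtracted until an entry of [f] vanishes. No sign is reversed, and the difference is nonzero
    because [h] vanishes somewhere on [supp f]. *)
Lemma exists_elementary_sign (R : realType) (m n : nat) (A : 'M[R]_(m, n))
    (f : 'cV[R]_n) :
  A *m f = 0 -> f != 0 ->
  exists g, elementary A g /\
    forall i, (0 < g i 0 -> 0 < f i 0) /\ (g i 0 < 0 -> f i 0 < 0).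
Proof.
have [k] := ubnP #|supp f|; elim: k f => // k IH f ltk Af f0.
have [elf|nelf] := pselect (elementary A f); first by exists f.
have [h [h0 Ah /properP [hf [i1 i1f i1h]]]] : exists h : 'cV[R]_n,
    [/\ h != 0, A *m h = 0 & supp h \proper supp f].
  by apply: contrapT => ?; apply: nelf.
have hN0 i : h i 0 != 0 -> f i 0 != 0.
  by move=> hi; rewrite -in_supp (fintype.subsetP hf) ?in_supp.
(* Up to replacing [h] by [- h], some entry of [h] has the sign of [f], so the ratio test applies to
   [h] signed by [f] against [|f|]. *)
wlog [j hj] : h h0 Ah hf i1h hN0 / exists j, 0 < h j 0 * Num.sg (f j 0).
  move=> W; have [j hj] := cV_neq0 h0.
  have fj := hN0 _ hj.
  have [pos|neg] := ltP 0 (h j 0 * Num.sg (f j 0)).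
    by apply: (W h) => //; exists j.
  have suppN : supp (- h) = supp h.
    by apply/setP => i; rewrite !in_supp mxE oppr_eq0.
  apply: (W (- h)); rewrite ?suppN ?oppr_eq0 //.
  - by rewrite mulmxN Ah oppr0.
  - by move=> i; rewrite mxE oppr_eq0; apply: hN0.
  exists j; rewrite mxE mulNr oppr_gt0 lt_neqAle neg andbT.
  by rewrite mulf_eq0 sgr_eq0 negb_or hj fj.
have [||a [i [a0 hi ai le_a]]] := @maximal_step R n (fun i => `|f i 0|)
    (fun i => h i 0 * Num.sg (f i 0)) (ex_intro _ j hj); last 1 first.
- have fi : f i 0 != 0 by apply: contraTneq hi => ->; rewrite sgr0 mulr0 ltxx.
  have sg_a l : (0 < f l 0 -> 0 <= f l 0 - a * h l 0) /\
      (f l 0 < 0 -> f l 0 - a * h l 0 <= 0).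
    split=> fl; have := le_a l.
      by rewrite gtr0_sg // gtr0_norm // mulr1 subr_ge0.
    by rewrite ltr0_sg // ltr0_norm // mulrN1 mulrN lerN2 subr_le0.
  have sub l : (f - a *: h) l 0 != 0 -> f l 0 != 0.
    move=> E; apply: contraNneq E => fl; rewrite !mxE fl.
    have [->|/hN0] := eqVneq (h l 0) 0; last by rewrite fl eqxx.
    by rewrite mulr0 subr0.
  have [|||g [elg sg]] := IH (f - a *: h) _; last 1 first.
  + exists g; split=> // l; have [+ +] := sg l; have [] := sg_a l.
    have := sub l; rewrite !mxE => sl p1 p2 p3 p4.
    case: (ltgtP (f l 0) 0) => fl; split=> // gl.
    * by have := p3 gl; rewrite ltNge p2.
    * by have := p4 gl; rewrite ltNge p1.
    * by have := sl (lt0r_neq0 (p3 gl)); rewrite fl eqxx.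
    * by have := sl (ltr0_neq0 (p4 gl)); rewrite fl eqxx.
  + rewrite -ltnS; apply: leq_trans ltk; rewrite ltnS; apply: proper_card.
    apply/properP; split; first by apply/fintype.subsetP => l; rewrite !in_supp => /sub.
    exists i; rewrite in_supp // negbK !mxE subr_eq0.
    case: (ltgtP (f i 0) 0) fi ai => // fi _.
      rewrite ltr0_sg // ltr0_norm // mulrN1 mulrN => /oppr_inj ->; exact: eqxx.
    rewrite gtr0_sg // gtr0_norm // mulr1 => ->; exact: eqxx.
  + by rewrite mulmxBr Af -scalemxAr Ah scaler0 subr0.
  apply: contraTneq i1f => E; rewrite in_supp negbK.
  have := congr1 (fun z : 'cV_n => z i1 0) E; rewrite !mxE.
  by move: i1h; rewrite in_supp negbK => /eqP ->; rewrite mulr0 subr0 => ->.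
- by move=> l hl; rewrite normr_gt0; apply: contraTneq hl => ->;
    rewrite sgr0 mulr0 ltxx.
- by move=> l; exact: normr_ge0.
Qed.

Definition conformal (R : realType) (n : nat) (g f : 'cV[R]_n) : Prop :=
  forall i, (0 <= g i 0 <= f i 0) \/ (f i 0 <= g i 0 <= 0).

(* Pigeonhole over a conformal decomposition of [f] into [q] circuits. *)
Lemma exists_large_conformal (R : realType) (m n q : nat) (A : 'M[R]_(m, n))
    (f : 'cV[R]_n) i0 :
  (#|supp f| <= q)%N -> A *m f = 0 -> 0 < f i0 0 ->
  exists g, [/\ elementary A g, conformal g f & f i0 0 <= q%:R * g i0 0].
Proof.
elim: q f => [|q IH] f leq Af fi0.
  by move: leq; rewrite leqn0 cards_eq0 => /eqP/setP/(_ i0);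
    rewrite in_supp inE gt_eqF.
have f0 : f != 0 by apply: contraTneq fi0 => ->; rewrite mxE ltxx.
have [g [elg sg]] := exists_elementary_sign Af f0.
have [g0 Ag _] := elg; have [j gj] := cV_neq0 g0.
have hj : 0 < g j 0 * Num.sg (f j 0).
  have [s1 s2] := sg j; case: (ltgtP (g j 0) 0) gj => // gj _.
    by rewrite ltr0_sg ?s2 // mulrN1 oppr_gt0.
  by rewrite gtr0_sg ?s1 // mulr1.
(* The largest multiple of [g] that is still conformal to [f]; it exhausts entry [i] of [f]. *)
have [||a [i [a0 hi ai le_a]]] := @maximal_step R n (fun i => `|f i 0|)
    (fun i => g i 0 * Num.sg (f i 0)) (ex_intro _ j hj); last 1 first.
- have cf : conformal (a *: g) f.
    move=> l; rewrite mxE; have [s1 s2] := sg l; have := le_a l.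
    case: (ltgtP (f l 0) 0) => fl.
    + rewrite ltr0_sg // ltr0_norm // mulrN1 mulrN lerN2 => H; right.
      rewrite H /= pmulr_rle0 // leNgt; apply/negP => /s1; lra.
    + rewrite gtr0_sg // gtr0_norm // mulr1 => H; left.
      rewrite H andbT pmulr_rge0 // leNgt; apply/negP => /s2; lra.
    + have -> : g l 0 = 0.
        by case: (ltgtP (g l 0) 0) => // gl; [move/s2: gl | move/s1: gl]; rewrite fl ltxx.
      by move=> _; left; rewrite mulr0 fl lexx.
  (* If the piece [a g] is too small at [i0], the remainder keeps more than the fraction
     [q / (q + 1)] of [f i0] and has smaller support, so [q] pieces suffice for it. *)
  have [big|small] := leP (f i0 0) (q.+1%:R * (a * g i0 0)).
    exists (a *: g); split => //; first by apply: elementary_scale elg; rewrite gt_eqF.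
    by rewrite mxE.
  have fi : f i 0 != 0 by apply: contraTneq hi => ->; rewrite sgr0 mulr0 ltxx.
  have cf' l : (0 <= (f - a *: g) l 0 <= f l 0) \/ (f l 0 <= (f - a *: g) l 0 <= 0).
    have := cf l; rewrite !mxE => -[] H; [left|right]; lra.
  have q0 : 0 <= q%:R :> R by [].
  have sm : (q%:R + 1) * (a * g i0 0) < f i0 0 by rewrite natr1.
  have ag : 0 <= a * g i0 0 by have := cf i0; rewrite mxE; lra.
  have [|||g' [elg' cg' leg']] := IH (f - a *: g).
  + rewrite -ltnS; apply: leq_trans leq; apply: proper_card.
    apply/properP; split.
      apply/fintype.subsetP => l; rewrite !in_supp; apply: contra_neq => fl.
      by have := cf' l; rewrite fl => -[] H; lra.
    exists i; rewrite in_supp // negbK !mxE subr_eq0.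
    case: (ltgtP (f i 0) 0) fi ai => // fi _.
      rewrite ltr0_sg // ltr0_norm // mulrN1 mulrN => /oppr_inj ->; exact: eqxx.
    rewrite gtr0_sg // gtr0_norm // mulr1 => ->; exact: eqxx.
  + by rewrite mulmxBr Af -scalemxAr Ag scaler0 subr0.
  + rewrite !mxE; nra.
  exists g'; split=> //.
    by move=> l; have [] := cg' l; have [] := cf' l => ? ?; [left|right|left|right]; lra.
  move: leg'; rewrite !mxE -natr1 => leg'.
  have g'0 : 0 <= g' i0 0.
    by have [] := cg' i0; have [] := cf' i0; rewrite !mxE; nra.
  nra.
- move=> l hl; rewrite normr_gt0; apply: contraTneq hl => ->.
  by rewrite sgr0 mulr0 ltxx.
- by move=> l; exact: normr_ge0.
Qed.

(** * Vertices of the polyhedron *)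

Lemma feasible_scaling (R : realFieldType) (n : nat) (x h : 'I_n -> R) :
  (forall i, 0 < h i -> 0 < x i) -> (forall i, 0 <= x i) ->
  exists a, 0 < a /\ forall j, a * h j <= x j.
Proof.
move=> hx x0; have [[i hi]|nh] := pselect (exists i, 0 < h i).
  by have [a [_ [a0 _ _ le_a]]] := maximal_step (ex_intro _ i hi) hx x0; exists a.
exists 1; split=> // j; rewrite mul1r; apply: le_trans (x0 j).
by rewrite leNgt; apply/negP => hj; apply: nh; exists j.
Qed.

(** Such an [h] makes [u] the midpoint of the feasible points [u + a h] and [u - a h] for small
    [a > 0], so extremality forces [h = 0]. *)
Lemma vertex_ker (R : realType) (m n : nat) (A : 'M[R]_(m, n)) b
    (u h : 'cV[R]_n) :
  vertex (polyhedron A b) u -> A *m h = 0 ->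
  (forall i, u i 0 = 0 -> h i 0 = 0) -> h = 0.
Proof.
move=> [[Au u0] ext] Ah hu.
have [i|a [a0 le_a]] := @feasible_scaling R n (fun i => u i 0)
    (fun i => `|h i 0|) _ u0.
  by rewrite normr_gt0 lt0r u0 andbT => /eqP hi; apply/eqP => /hu.
have inP s : `|s| <= a -> polyhedron A b (u + s *: h).
  move=> sa; split; first by rewrite mulmxDr Au -scalemxAr Ah scaler0 addr0.
  move=> i; rewrite !mxE -lerBlDr sub0r; apply: le_trans (ler_norm _) _.
  by rewrite normrN normrM; apply: le_trans (le_a i); rewrite ler_wpM2r.
have [||||_ E] := ext _ _ (1 / 2) (inP a _) (inP (- a) _).
- by rewrite gtr0_norm.
- by rewrite normrN gtr0_norm.
- by lra.
- by apply/colP => i; rewrite !mxE; field.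
apply/colP => i; have := congr1 (fun z : 'cV_n => z i 0) E; rewrite !mxE => Ei.
by apply/eqP; move: a0; have /eqP : a * h i 0 = 0 by [lra]; rewrite mulf_eq0 => /orP[/eqP->|//]; rewrite ltxx.
Qed.

(** More than [m] columns of [A] are dependent, and a dependence among the columns in [supp u]
    contradicts [vertex_ker]. *)
Lemma vertex_supp (R : realType) (m n : nat) (A : 'M[R]_(m, n)) b
    (u : 'cV[R]_n) :
  vertex (polyhedron A b) u -> (#|supp u| <= m)%N.
Proof.
move=> vu; rewrite leqNgt; apply/negP => ltm.
(* [E] selects the coordinates in [supp u]; [w *m E] is [w] extended by zero. *)
pose E : 'M[R]_(#|supp u|, n) := \matrix_(j, i) (i == enum_val j)%:R.
have /rowV0Pn [w /sub_kermxP wE w0] : kermx (E *m A^T) != 0.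
  rewrite -mxrank_eq0 mxrank_ker -lt0n subn_gt0.
  exact: leq_ltn_trans (rank_leq_col _) ltm.
have : (w *m E)^T = 0.
  apply: vertex_ker vu _ _.
    by apply: trmx_inj; rewrite trmx_mul trmxK -mulmxA wE trmx0.
  move=> i ui; rewrite !mxE big1 // => j _; rewrite mxE.
  have [Ei|] := eqVneq i (enum_val j); last by rewrite mulr0.
  by have := enum_valP j; rewrite -Ei in_supp ui eqxx.
move/colP => wE0; case/eqP: w0; apply/rowP => j.
have := wE0 (enum_val j); rewrite !mxE (bigD1 j) //= big1 => [|l lj].
  by rewrite mxE eqxx mulr1 addr0.
by rewrite mxE eq_sym (inj_eq enum_val_inj) (negPf lj) mulr0.
Qed.

(** * Monotone circuit walks *)

(** An inductive form of monotone circuit walks, which concatenate more easily than indexed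
    sequences. *)
Inductive monotone_path (R : realType) (m n : nat) (A : 'M[R]_(m, n))
    (b : 'cV[R]_m) (c : 'cV[R]_n) : nat -> 'cV[R]_n -> 'cV[R]_n -> Prop :=
| path_nil x : polyhedron A b x -> monotone_path A b c 0 x x
| path_cons k x y z : polyhedron A b x -> circuit_step A b x y ->
    objective c y <= objective c x -> monotone_path A b c k y z ->
    monotone_path A b c k.+1 x z.

Lemma monotone_path_cat (R : realType) (m n : nat) (A : 'M[R]_(m, n)) b c
    k l (x y z : 'cV[R]_n) :
  monotone_path A b c k x y -> monotone_path A b c l y z ->
  monotone_path A b c (k + l) x z.
Proof.
elim=> // k' x' y' z' Px st le_c _ IH yz; rewrite addSn.
exact: path_cons Px st le_c (IH yz).
Qed.

Lemma monotone_path_walk (R : realType) (m n : nat) (A : 'M[R]_(m, n)) b c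
    k (x y : 'cV[R]_n) :
  monotone_path A b c k x y ->
  exists w, circuit_walk A b k w x y /\ monotone_walk c k w.
Proof.
elim=> [z Pz|l z z' t Pz st le_c _ [w [[w0 wl wP ws] wc]]].
  by exists (fun=> z).
exists (fun i => if i is j.+1 then w j else z); split; first split=> //.
- by case=> [|i] //; apply: wP.
- by case=> [_|i]; [rewrite w0|apply: ws].
- by case=> [_|i]; [rewrite w0|apply: wc].
Qed.

(** For small [a > 0] the point [v + a g] is feasible and cannot beat [v]. This makes the steps from
    [x] to [x - a g] monotone. *)
Lemma objective_argmin (R : realType) (m n : nat) (A : 'M[R]_(m, n)) b
    (c v g : 'cV[R]_n) :
  argmin (polyhedron A b) c v -> A *m g = 0 ->
  (forall i, v i 0 = 0 -> 0 <= g i 0) -> 0 <= objective c g.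
Proof.
move=> [[Av v0] vmin] Ag gv.
have [i gi|a [a0 le_a]] := @feasible_scaling R n (fun i => v i 0)
    (fun i => - g i 0) _ v0.
  by rewrite lt0r v0 andbT; apply: contraTneq gi => /gv; rewrite oppr_gt0 -leNgt.
have /vmin : polyhedron A b (v + a *: g).
  split=> [|i]; first by rewrite mulmxDr Av -scalemxAr Ag scaler0 addr0.
  by rewrite !mxE -[a * _]opprK subr_ge0 -mulrN.
by rewrite /objective mulmxDr -scalemxAr !mxE lerDl pmulr_rge0.
Qed.

(** The move is along [- g]; it is maximal because the blocking entry [i] reaches 0. *)
Lemma exists_circuit_step (R : realType) (m n : nat) (A : 'M[R]_(m, n)) b
    (x g : 'cV[R]_n) :
  polyhedron A b x -> elementary A g -> (exists i, 0 < g i 0) ->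
  (forall i, 0 < g i 0 -> 0 < x i 0) ->
  exists a i, [/\ 0 < a, 0 < g i 0, a * g i 0 = x i 0,
    polyhedron A b (x - a *: g) & circuit_step A b x (x - a *: g)].
Proof.
move=> [Ax x0] elg ig gx; have [_ Ag _] := elg.
have [a [i [a0 gi ai le_a]]] := maximal_step ig gx x0.
exists a, i; split=> //.
  split=> [|j]; first by rewrite mulmxBr Ax -scalemxAr Ag scaler0 subr0.
  by rewrite !mxE subr_ge0.
exists (- g), a; split=> //; first by rewrite -scaleN1r; apply: elementary_scale; rewrite ?oppr_eq0 ?oner_eq0.
  by rewrite scalerN.
by move=> a' lta [_ /(_ i)]; rewrite !mxE -ai; nra.
Qed.

(** * Shrinking one coordinate and killing a large one *)

Definition large (R : realType) (p n : nat) (v x : 'cV[R]_n) : {set 'I_n} :=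
  [set i | p%:R * v i 0 < x i 0]%SET.

(** All points stay supported in [S], which keeps the pigeonhole factor of the decomposition at
    [p]. *)
Lemma shrink_step (R : realType) (m n p : nat) (A : 'M[R]_(m, n)) b
    (c v x : 'cV[R]_n) (S : {set 'I_n}) i0 :
  (#|S| <= p)%N -> supp v \subset S -> supp x \subset S ->
  argmin (polyhedron A b) c v -> polyhedron A b x ->
  v i0 0 = 0 -> 0 < x i0 0 ->
  exists y, [/\ polyhedron A b y, circuit_step A b x y,
    objective c y <= objective c x,
    (supp y \subset S) && (large p v y \subset large p v x) &
    p%:R * y i0 0 <= (p%:R - 1) * x i0 0].
Proof.
move=> leS Sv Sx minv Px vi0 xi0.
have [[Av v0] _] := minv; have [Ax x0] := Px.
have supp0 (z : 'cV[R]_n) l : l \notin S -> supp z \subset S -> z l 0 = 0.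
  by move=> lS /fintype.subsetP sz; apply: contraNeq lS; rewrite -in_supp; apply: sz.
have Sf : (#|supp (x - v)| <= p)%N.
  apply: leq_trans leS; apply: subset_leq_card; apply/fintype.subsetP => l.
  rewrite in_supp !mxE; apply: contra_neqT => lS.
  by rewrite (supp0 x l lS) // (supp0 v l lS) // subrr.
have Af : A *m (x - v) = 0 by rewrite mulmxBr Ax Av subrr.
have fi0 : 0 < (x - v) i0 0 by rewrite !mxE vi0 subr0.
have [g [elg cg leg]] := exists_large_conformal Sf Af fi0.
have [_ Ag _] := elg.
have p0 : (0 : R) <= p%:R by [].
have gi0 : 0 < g i0 0 by nra.
have gx i : 0 < g i 0 -> 0 < x i 0.
  by have := v0 i; have [] := cg i; rewrite !mxE; lra.
have [a [i [a0 gi ai Py st]]] := exists_circuit_step Px elg (ex_intro _ i0 gi0) gx.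
exists (x - a *: g); move: fi0 leg; rewrite !mxE vi0 subr0 => _ leg.
(* At the blocking entry, [g i <= x i - v i <= x i = a * g i]. *)
have a1 : 1 <= a.
  by have := v0 i; have [] := cg i; rewrite !mxE; nra.
(* Feasibility at [i0] gives [a * g i0 <= x i0 <= p * g i0]. *)
have ap : a <= p%:R.
  by have [_ /(_ i0)] := Py; rewrite !mxE; nra.
split=> //.
- have : 0 <= objective c g.
    apply: (objective_argmin minv Ag) => l vl.
    by have := x0 l; have [] := cg l; rewrite !mxE vl; lra.
  by rewrite /objective mulmxBr -scalemxAr !mxE; nra.
- apply/andP; split; apply/fintype.subsetP => l.
    rewrite in_supp !mxE; apply: contra_neqT => lS.
    have := cg l; rewrite !mxE (supp0 x l lS) // (supp0 v l lS) // => gl.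
    have -> : g l 0 = 0 by lra.
    by rewrite mulr0 subrr.
  (* An increasing entry ends at most at [x l + p * (v l - x l) <= p * v l], so it does not become
     large. *)
  rewrite !inE !mxE; have := v0 l; have := x0 l; have := cg l; rewrite !mxE.
  by move=> [] /andP[g1 g2] xl vl; nra.
- by nra.
Qed.

Lemma shrink_path (R : realType) (m n p L : nat) (A : 'M[R]_(m, n)) b
    (c v x : 'cV[R]_n) (S : {set 'I_n}) i0 :
  (0 < p)%N -> (#|S| <= p)%N -> supp v \subset S -> supp x \subset S ->
  argmin (polyhedron A b) c v -> polyhedron A b x -> v i0 0 = 0 ->
  exists k y, [/\ (k <= L)%N, monotone_path A b c k x y, polyhedron A b y,
    (supp y \subset S) && (large p v y \subset large p v x) &
    y i0 0 <= (1 - p%:R^-1) ^+ L * x i0 0].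
Proof.
move=> p0 leS Sv Sx minv Px vi0; elim: L x Sx Px => [|L IH] x Sx Px.
  exists 0%N, x; split=> //; first exact: path_nil.
  - by rewrite Sx subxx.
  - by rewrite expr0 mul1r.
have pR : (0 : R) < p%:R by rewrite ltr0n.
(* Once entry [i0] is 0 the path stops early, hence [k <= L] rather than equality. *)
have xi0 := Px.2 i0; have [xi1|xi1] := leP (x i0 0) 0.
  exists 0%N, x; split=> //; first exact: path_nil.
  - by rewrite Sx subxx.
  - by have -> : x i0 0 = 0 by [lra]; rewrite mulr0.
have [y [Py st le_c /andP[Sy Ty] ley]] := shrink_step leS Sv Sx minv Px vi0 xi1.
have [k [z [leL yz Pz /andP[Sz Tz] lez]]] := IH y Sy Py.
exists k.+1, z; split=> //; first exact: path_cons Px st le_c yz.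
  by rewrite Sz (fintype.subset_trans Tz Ty).
apply: le_trans lez _; rewrite exprSr -mulrA; apply: ler_wpM2l.
  by rewrite exprn_ge0 // subr_ge0 invf_le1 // ler1n.
by rewrite -(ler_pM2l pR) mulrA mulrBr mulr1 divff ?gt_eqF.
Qed.

(* The circuit is conformal to [2p (x1 - v) + (x0 - v)]. The first term keeps
   the small coordinates below [v / 2] from decreasing; the pieces of the second
   one are too short, relative to [x1 i0], to exhaust any other small
   coordinate. *)
Lemma kill_step (R : realType) (m n p : nat) (A : 'M[R]_(m, n)) b
    (c v x0 x1 : 'cV[R]_n) (S : {set 'I_n}) i0 :
  (2 <= p)%N -> (#|S| <= p)%N ->
  supp v \subset S -> supp x0 \subset S -> supp x1 \subset S ->
  argmin (polyhedron A b) c v -> polyhedron A b x0 -> polyhedron A b x1 ->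
  large p v x0 = large p v x1 ->
  v i0 0 = 0 -> 0 < x1 i0 0 -> 6 * p%:R ^+ 3 * x1 i0 0 <= x0 i0 0 ->
  exists y, [/\ polyhedron A b y, circuit_step A b x1 y,
    objective c y <= objective c x1, supp y \subset S &
    large p v y \proper large p v x1].
Proof.
move=> p2 leS Sv Sx0 Sx1 minv P0 P1 eqT vi0 xi1 xi0.
have [[Av v0] _] := minv; have [Ax0 x00] := P0; have [Ax1 x10] := P1.
have supp0 (z : 'cV[R]_n) l : l \notin S -> supp z \subset S -> z l 0 = 0.
  by move=> lS /fintype.subsetP sz; apply: contraNeq lS; rewrite -in_supp; apply: sz.
pose f := (2 * p%:R) *: (x1 - v) + (x0 - v).
have fE l : f l 0 = 2 * p%:R * (x1 l 0 - v l 0) + (x0 l 0 - v l 0).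
  by rewrite /f !mxE.
have Sf : (#|supp f| <= p)%N.
  apply: leq_trans leS; apply: subset_leq_card; apply/fintype.subsetP => l.
  rewrite in_supp fE; apply: contra_neqT => lS.
  by rewrite (supp0 x0 l lS) // (supp0 x1 l lS) // (supp0 v l lS) // subrr mulr0 addr0.
have Af : A *m f = 0.
  by rewrite mulmxDr -scalemxAr !mulmxBr Ax0 Ax1 Av !subrr scaler0 addr0.
have pR : (2 : R) <= p%:R by rewrite ler_nat.
have q4 : (4 : R) <= p%:R ^+ 2 by rewrite expr2; nra.
have fi0 : x0 i0 0 <= f i0 0 by rewrite fE vi0 !subr0; nra.
have fpos : 0 < f i0 0 by have : 0 < p%:R ^+ 3 * x1 i0 0; [rewrite mulr_gt0 // exprn_gt0 //; lra|lra].
have [g [elg cg leg]] := exists_large_conformal Sf Af fpos.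
have [_ Ag _] := elg.
have gi0 : 0 < g i0 0 by nra.
(* At a small entry [x0 l <= p * v l], so [f l > 0] forces [2p * x1 l > (p + 1) * v l]. *)
have large_pos l : 0 < f l 0 -> 0 < x1 l 0 /\ (l \notin large p v x1 -> v l 0 / 2 < x1 l 0 /\ f l 0 <= 2 * p%:R * x1 l 0 + p%:R * v l 0).
  have := x10 l; have := v0 l; rewrite fE => vl xl fl; split.
    have [lT|lT] := boolP (l \in large p v x1).
      by move: lT; rewrite inE; nra.
    by move: (lT); rewrite -eqT inE -leNgt; nra.
  by move=> lT; move: (lT) (lT); rewrite -{1}eqT !inE -!leNgt; split; nra.
have gx l : 0 < g l 0 -> 0 < x1 l 0.
  by move=> gl; have [] := cg l => H; [have [] := large_pos l|]; lra.
have [a [i [a0 gi ai Py st]]] := exists_circuit_step P1 elg (ex_intro _ i0 gi0) gx.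
(* Here [p * g i0 >= f i0 >= x0 i0 >= 6 p^3 * x1 i0], whereas feasibility gives
   [a * g i0 <= x1 i0]. *)
have a6 : a * (6 * p%:R ^+ 2) <= 1.
  have [_ /(_ i0)] := Py; rewrite !mxE => ag.
  have H : p%:R * (6 * p%:R ^+ 2 * x1 i0 0) <= p%:R * g i0 0.
    by apply: le_trans leg; apply: le_trans fi0; apply: le_trans xi0; rewrite exprS; lra.
  have {}H : 6 * p%:R ^+ 2 * x1 i0 0 <= g i0 0 by rewrite -(ler_pM2l (x := p%:R)) //; lra.
  by rewrite -(ler_pM2r xi1); nra.
exists (x1 - a *: g); split=> //.
- have : 0 <= objective c g.
    apply: (objective_argmin minv Ag) => l vl.
    by have := x00 l; have := x10 l; have [] := cg l; rewrite fE vl; nra.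
  by rewrite /objective mulmxBr -scalemxAr !mxE; nra.
- apply/fintype.subsetP => l.
  rewrite in_supp !mxE; apply: contra_neqT => lS.
  have := cg l; rewrite fE (supp0 x0 l lS) // (supp0 x1 l lS) // (supp0 v l lS) // => gl.
  have -> : g l 0 = 0 by lra.
  by rewrite mulr0 subrr.
apply/properP; split.
  apply/fintype.subsetP => l; apply: contraLR => lT.
  move: (lT) (lT); rewrite -{1}eqT !inE -!leNgt !mxE => l0 l1.
  have vl := v0 l; have x0l := x00 l; have x1l := x10 l.
  have [gl|gl] := leP 0 (g l 0); first by nra.
  (* A small entry that increases starts at most at [5/4 * v l] and gains at most [v l / 2], so it
     ends below or at [2 * v l <= p * v l]. *)
  have fl : f l 0 <= g l 0 by have [] := cg l; lra.
  have : - f l 0 <= (2 * p%:R + 1) * v l 0 by rewrite fE; nra.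
  have : x1 l 0 <= 5 / 4 * v l 0 by move: fl; rewrite fE; nra.
  have : a * ((2 * p%:R + 1) * v l 0) <= v l 0 / 2.
    have : a * (2 * p%:R + 1) <= 1 / 2 by rewrite expr2 in a6; nra.
    nra.
  nra.
exists i; last by rewrite inE !mxE ai subrr -leNgt mulr_ge0.
(* Were the blocking entry small, [g i <= f i < 4p * x1 i], while [a * g i = x1 i] and the bound on
   [a] give [g i >= 6 p^2 * x1 i]. *)
apply: contraT => iT; have fi : 0 < f i 0 /\ g i 0 <= f i 0 by have [] := cg i; lra.
have [xi /(_ iT) [vi fi']] := large_pos i fi.1; have v0i := v0 i.
have : a * (6 * p%:R ^+ 2) * g i 0 <= g i 0 by rewrite ger_pMl.
have -> : a * (6 * p%:R ^+ 2) * g i 0 = 6 * p%:R ^+ 2 * (a * g i 0) by ring.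
rewrite ai; nra.
Qed.

(** * Reaching the target vertex *)

(** Otherwise [x - v] is a kernel vector vanishing wherever [v] does, hence zero by [vertex_ker]. *)
Lemma exists_positive_off_vertex (R : realType) (m n : nat) (A : 'M[R]_(m, n)) b
    (v x : 'cV[R]_n) :
  vertex (polyhedron A b) v -> polyhedron A b x -> x != v ->
  exists i, v i 0 = 0 /\ 0 < x i 0.
Proof.
move=> vv [Ax x0] xv; have [[Av _] _] := vv.
apply: contrapT => no; case/eqP: xv; apply: subr0_eq.
apply: (vertex_ker vv) => [|i vi]; first by rewrite mulmxBr Ax Av subrr.
rewrite !mxE vi subr0; apply/eqP; rewrite eq_le x0 andbT leNgt.
by apply/negP => xi; apply: no; exists i.
Qed.

(** Induction on the number of large entries: each round has at most [L] shrinking steps, plus one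
    killing step if these removed no large entry. *)
Lemma path_to_vertex (R : realType) (m n p L t : nat) (A : 'M[R]_(m, n)) b
    (c v x : 'cV[R]_n) (S : {set 'I_n}) :
  (2 <= p)%N -> (#|S| <= p)%N -> supp v \subset S -> supp x \subset S ->
  vertex (polyhedron A b) v -> argmin (polyhedron A b) c v ->
  polyhedron A b x -> 6 * p%:R ^+ 3 * (1 - p%:R^-1) ^+ L <= 1 :> R ->
  (#|large p v x| <= t)%N ->
  exists k, (k <= t * L.+1)%N /\ monotone_path A b c k x v.
Proof.
move=> p2 leS Sv Sx vv minv Px leL; elim: t x Sx Px => [|t IH] x Sx Px leT.
  (* A positive entry where [v] vanishes is large, so without large entries [x = v]. *)
  exists 0%N; split=> //; have [->|xv] := eqVneq x v.
    by apply: path_nil; case: minv.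
  have [i0 [vi0 xi0]] := exists_positive_off_vertex vv Px xv.
  by move: leT; rewrite leqn0 cards_eq0 => /eqP/setP/(_ i0); rewrite !inE vi0 mulr0 xi0.
have [->|xv] := eqVneq x v.
  by exists 0%N; split=> //; apply: path_nil; case: minv.
have [i0 [vi0 xi0]] := exists_positive_off_vertex vv Px xv.
have i0T : i0 \in large p v x by rewrite inE vi0 mulr0.
have [k [y [lek xy Py /andP[Sy Ty] ley]]] :=
  shrink_path L (ltnW p2) leS Sv Sx minv Px vi0.
have [eqT|neqT] := eqVneq (large p v y) (large p v x); last first.
  have [|l [lel yv]] := IH y Sy Py.
    rewrite -ltnS; apply: leq_trans leT; apply: proper_card.
    by rewrite finset.properEneq neqT.
  exists (k + l)%N; split; last exact: monotone_path_cat xy yv.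
  by rewrite mulSn leq_add // ltnW.
have yi0 : 0 < y i0 0 by move: i0T; rewrite -eqT inE vi0 mulr0.
have shrunk : 6 * p%:R ^+ 3 * y i0 0 <= x i0 0.
  have p3 : 0 <= 6 * p%:R ^+ 3 :> R by rewrite mulr_ge0 ?exprn_ge0.
  by have := ler_wpM2l p3 ley; nra.
have [z [Pz st le_c Sz Tz]] :=
  kill_step p2 leS Sv Sx Sy minv Px Py (esym eqT) vi0 yi0 shrunk.
have [|l [lel zv]] := IH z Sz Pz.
  by rewrite -ltnS; apply: leq_trans leT; rewrite -eqT; apply: proper_card.
exists (k + l.+1)%N; split.
  by rewrite addnS -addSn mulSn leq_add.
exact: monotone_path_cat xy (path_cons Py st le_c zv).
Qed.

(** * Number of shrinking steps and final count *)

(** Since [1 - 1/(2m) <= exp (- 1/(2m))], taking [L >= 18 m ln m] brings the power down to [m^-9],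
    which absorbs the cubic factor. *)
Lemma shrink_length (R : realType) (m : nat) : (2 <= m)%N ->
  exists L : nat, L%:R <= 18 * m%:R * ln m%:R + 1 :> R /\
    6 * (2 * m)%:R ^+ 3 * (1 - (2 * m)%:R^-1) ^+ L <= 1 :> R.
Proof.
move=> m2; have mR : (2 : R) <= m%:R by rewrite ler_nat.
have m0 : (0 : R) < m%:R by lra.
have ln0 : 0 <= ln m%:R :> R by rewrite ln_ge0 //; lra.
have x0 : 0 <= 18 * m%:R * ln m%:R :> R by rewrite !mulr_ge0 // ltW.
have /andP[le_tr lt_tr] := truncn_itv x0.
exists (Num.truncn (18 * m%:R * ln m%:R : R)).+1; split.
  by rewrite -natr1 lerD2r.
set L := (Num.truncn _).+1 in lt_tr *.
have pm : (0 : R) < (2 * m)%:R by rewrite natrM; lra.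
have inv1 : 0 <= 1 - (2 * m)%:R^-1 :> R.
  by rewrite subr_ge0 invf_le1 // natrM; lra.
have le_exp : (1 - (2 * m)%:R^-1) ^+ L <= expR (- (9 * ln m%:R)) :> R.
  apply: (@le_trans _ _ (expR (- (2 * m)%:R^-1) ^+ L)).
    by apply: lerXn2r; rewrite ?nnegrE ?expR_ge0 // expR_ge1Dx.
  rewrite -expRM_natl ler_expR mulrN lerN2 ler_pdivlMr // natrM; lra.
have E9 : expR (9 * ln m%:R) = m%:R ^+ 9 :> R by rewrite expRM_natl lnK.
apply: le_trans (_ : m%:R ^+ 9 * expR (- (9 * ln m%:R)) <= 1); last first.
  by rewrite -E9 -expRD subrr expR0.
apply: ler_pM => //; rewrite ?mulr_ge0 ?exprn_ge0 //.
(* 6 (2m)^3 <= m^9 because 48 <= 2^6 *)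
have m6 : 2 ^+ 6 <= m%:R ^+ 6 :> R by apply: lerXn2r; rewrite ?nnegrE.
have m3 : 0 <= m%:R ^+ 3 :> R by rewrite exprn_ge0.
rewrite natrM exprMn (exprD _ 6 3); nra.
Qed.

Theorem corollary3p10 (R : realType) :
  exists C : R, 0 < C /\
    forall (m n : nat) (A : 'M[R]_(m, n)) (b : 'cV[R]_m),
      (2 <= m)%N -> \rank A = m ->
      (monotone_circuit_diameter A b <= (C * m%:R ^+ 2 * ln m%:R)%:E)%E.
Proof.
have ln2 : 0 < ln 2 :> R by rewrite ln_gt0 // ltr1n.
(* The count is [2m (L + 1) <= 36 m^2 ln m + 4m], and [4m <= 4 m^2 ln m / ln 2] as [m >= 2]. *)
exists (36 + 4 / ln 2); split; first by rewrite addr_gt0 // divr_gt0.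
move=> m n A b m2 _; apply: ub_ereal_sup => _ [u [v [c [vu vv minv ->]]]].
have [L [leL shrunk]] := shrink_length R m2.
pose S := (supp u :|: supp v)%SET.
have leS : (#|S| <= 2 * m)%N.
  rewrite mul2n -addnn; apply: leq_trans (leq_card_setU _ _) _.
  by rewrite leq_add // (vertex_supp vu, vertex_supp vv).
have leT : (#|large (2 * m) v u| <= 2 * m)%N.
  apply: leq_trans leS; apply: subset_leq_card; apply/fintype.subsetP => i.
  rewrite !inE => lt_i; apply/orP; left; rewrite gt_eqF //.
  by apply: le_lt_trans lt_i; rewrite mulr_ge0 //; case: vv => -[].
have m4 : (2 <= 2 * m)%N by rewrite leq_pmulr // ltnW.
have [k [lek uv]] := path_to_vertex m4 leS
  (finset.subsetUr _ _) (finset.subsetUl _ _) vv minv vu.1 shrunk leT.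
apply: (@le_trans _ _ (k%:R%:E)).
  by apply: ereal_inf_lbound; exists k => //; apply: monotone_path_walk uv.
rewrite lee_fin.
have mR : (2 : R) <= m%:R by rewrite ler_nat.
have ln2m : ln 2 <= ln m%:R :> R by rewrite ler_ln ?posrE //; lra.
have kR : k%:R <= 2 * m%:R * (L%:R + 1) :> R.
  by rewrite natr1 -!natrM ler_nat.
have r1 : 1 <= ln m%:R / ln 2 :> R by rewrite ler_pdivlMr // mul1r.
have : 4 * m%:R <= 4 * m%:R ^+ 2 * (ln m%:R / ln 2) :> R by rewrite expr2; nra.
have -> : (36 + 4 / ln 2) * m%:R ^+ 2 * ln m%:R =
  36 * m%:R ^+ 2 * ln m%:R + 4 * m%:R ^+ 2 * (ln m%:R / ln 2) :> R by ring.
nra.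
Qed.
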